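(* Let $q=2^s$ with $s\geq 2$ and let $V$ be the standard $2$-dimensional representation of $O_2^+(\mathbb{F}_q)$. Then for every integer $m\geq 1$ the Noether number of $mV$ is $$\beta_{mV}(O_2^+(\mathbb{F}_q))=\max\{q-1,m\}.$$
   Context: $O_2^+(\mathbb{F}_q)\subset\mathrm{GL}_2(\mathbb{F}_q)$ is the group generated by $\sigma=\begin{pmatrix}0&1\\1&0\end{pmatrix}$ and $\tau_a=\begin{pmatrix}a&0\\0&a^{-1}\end{pmatrix}$, $a\in\mathbb{F}_q^\times$. $mV$ is the direct sum of $m$ copies of $V$ with diagonal action, and $\mathbb{F}_q[mV]=\mathbb{F}_q[x_1,\dots,x_m,y_1,\dots,y_m]$ (standard grading) with action by algebra automorphisms $\sigma(x_i)=y_i$, $\sigma(y_i)=x_i$, $\tau_a(x_i)=a^{-1}x_i$, $\tau_a(y_i)=ay_i$. For a finite group $G$ and a finite-dimensional representation $W$ over a field $\mathbb{F}$, the Noether number $\beta_W(G)$ is the least $e$ such that the $\mathbb{F}$-algebra $\mathbb{F}[W]^G$ is generated by its homogeneous elements of degree at most $e$. *)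

(* Defs.v *)
From HB Require Import structures.
From mathcomp Require Import all_boot all_order all_algebra all_fingroup.
From mathcomp Require Import mxrepresentation.
From mathcomp Require Import mpoly.

Set Implicit Arguments.
Unset Strict Implicit.
Unset Printing Implicit Defensive.

Import GRing.Theory.
Local Open Scope ring_scope.

Inductive gen_subalg (R : comNzRingType) (A : algType R) (S : A -> Prop) :
    A -> Prop :=
| gen_subalg_scalar (c : R) : gen_subalg S c%:A
| gen_subalg_gen (f : A) : S f -> gen_subalg S f
| gen_subalg_add (f g : A) :
    gen_subalg S f -> gen_subalg S g -> gen_subalg S (f + g)
| gen_subalg_mul (f g : A) :
    gen_subalg S f -> gen_subalg S g -> gen_subalg S (f * g).

(* The matrices rG g act on column vectors, and 'X_i is the i-th coordinate
   function, so that (g . f)(v) = f(g^-1 v) reads as the substitution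
   'X_i |-> \sum_j (rG g^-1) i j *: 'X_j. *)
Definition poly_act (F : fieldType) (gT : finGroupType) (G : {group gT})
    (n : nat) (rG : mx_representation F G n) (g : gT) (f : {mpoly F[n]}) :
    {mpoly F[n]} :=
  f \mPo [tuple \sum_(j < n) rG (g^-1)%g i j *: 'X_j | i < n].

Definition invariant (F : fieldType) (gT : finGroupType) (G : {group gT})
    (n : nat) (rG : mx_representation F G n) (f : {mpoly F[n]}) : Prop :=
  forall g : gT, g \in G -> poly_act rG g f = f.

Definition generated_in_degree_le (F : fieldType) (gT : finGroupType)
    (G : {group gT}) (n : nat) (rG : mx_representation F G n) (e : nat) :
    Prop :=
  forall f : {mpoly F[n]}, invariant rG f ->
    gen_subalg
      (fun h => invariant rG h /\
                exists d : nat, (d <= e)%N /\ h \is d.-homog) f.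

(* Stated as a relation, so that no totality convention is needed. *)
Definition is_noether_number (F : fieldType) (gT : finGroupType)
    (G : {group gT}) (n : nat) (rG : mx_representation F G n) (e : nat) :
    Prop :=
  generated_in_degree_le rG e /\
  forall e' : nat, generated_in_degree_le rG e' -> (e <= e')%N.

Section O2plus.

Variable F : finFieldType.

Definition sigma_mx : 'M[F]_2 := \matrix_(i, j) (i != j)%:R.

Definition tau_mx (a : F) : 'M[F]_2 :=
  diag_mx (\row_j (if j == 0 then a else a^-1)).

Lemma sigma_mx_unit : sigma_mx \is a GRing.unit.
Proof.
have E : sigma_mx * sigma_mx = 1.
  apply/matrixP=> i j; rewrite !mxE !big_ord_recl big_ord0 !mxE.
  by case: i => [[|[|]]] //= ?; case: j => [[|[|]]] //= ?;
    rewrite /= ?mulr0 ?mul0r ?mulr1 ?add0r ?addr0.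
by apply/unitrP; exists sigma_mx.
Qed.

Lemma tau_mx_unit (a : {unit F}) : tau_mx (val a) \is a GRing.unit.
Proof.
have a0 : val a != 0 by rewrite -unitfE; exact: valP.
have : tau_mx (val a) \in unitmx; last by [].
rewrite unitmxE det_diag !big_ord_recl big_ord0 !mxE /= mulr1.
by rewrite divff ?unitr1.
Qed.

Definition sigma : {'GL_2[F]} := FinRing.unit _ sigma_mx_unit.

Definition tau (a : {unit F}) : {'GL_2[F]} := FinRing.unit _ (tau_mx_unit a).

Definition O2plus : {group {'GL_2[F]}} :=
  <<sigma |: [set tau a | a : {unit F}]>>%G.

(* The diagonal action on mV = V + ... + V in the coordinates
   (x_1, ..., x_m, y_1, ..., y_m), where (x_i, y_i) are the coordinates on the
   i-th copy of V. *)
Definition mV_mx (m : nat) (g : {'GL_2[F]}) : 'M[F]_(m + m) :=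
  let A : 'M[F]_2 := GLval g in
  block_mx (A 0 0)%:M (A 0 1)%:M (A 1 0)%:M (A 1 1)%:M.

Lemma mV_mx_repr (m : nat) : mx_repr O2plus (@mV_mx m).
Proof.
split.
  by rewrite /mV_mx /= !mxE /= scalar_mx_block raddf0.
move=> g h _ _; rewrite /mV_mx /= mulmx_block -!scalar_mxM -!raddfD /=.
rewrite !mxE !big_ord_recl !big_ord0 !addr0.
by have -> : lift ord0 ord0 = 1 :> 'I_2 by apply/val_inj.
Qed.

Definition mV (m : nat) : mx_representation F O2plus (m + m) :=
  MxRepresentation (@mV_mx_repr m).

Definition xvar (m : nat) (i : 'I_m) : {mpoly F[m + m]} := 'X_(lshift m i).
Definition yvar (m : nat) (i : 'I_m) : {mpoly F[m + m]} := 'X_(rshift m i).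

Lemma sigmaV : (sigma^-1)%g = sigma.
Proof.
apply/eqP; rewrite eq_invg_mul; apply/eqP/val_inj/matrixP=> i j /=.
rewrite !mxE !big_ord_recl big_ord0 !mxE.
by case: i => [[|[|]]] //= ?; case: j => [[|[|]]] //= ?;
  rewrite /= ?mulr0 ?mul0r ?mulr1 ?add0r ?addr0.
Qed.

Lemma tauV (a : {unit F}) : (tau a)^-1%g = tau a^-1%g.
Proof.
have a0 : val a != 0 by rewrite -unitfE; exact: valP.
apply/eqP; rewrite eq_invg_mul; apply/eqP/val_inj/matrixP=> i j /=.
rewrite !mxE !big_ord_recl big_ord0 !mxE.
by case: i => [[|[|]]] //= ?; case: j => [[|[|]]] //= ?;
  rewrite /= ?mulr0 ?mul0r ?addr0 ?add0r ?mulr0n ?mulr1n ?mulr0 ?mul0r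
    ?addr0 ?invrK ?divff ?mulVf.
Qed.

Lemma poly_act_xvar m g (i : 'I_m) :
  poly_act (mV m) g (xvar i) =
    (GLval g^-1%g 0 0 *: xvar i + GLval g^-1%g 0 1 *: yvar i).
Proof.
rewrite /poly_act comp_mpolyXU -tnth_nth tnth_mktuple big_split_ord /=.
congr (_ + _); rewrite (bigD1 i) //= big1 ?addr0 => [|j ji].
- by rewrite block_mxEul mxE eqxx mulr1n.
- by rewrite block_mxEul mxE eq_sym (negPf ji) mulr0n scale0r.
- by rewrite block_mxEur mxE eqxx mulr1n.
- by rewrite block_mxEur mxE eq_sym (negPf ji) mulr0n scale0r.
Qed.

Lemma poly_act_yvar m g (i : 'I_m) :
  poly_act (mV m) g (yvar i) =
    (GLval g^-1%g 1 0 *: xvar i + GLval g^-1%g 1 1 *: yvar i).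
Proof.
rewrite /poly_act comp_mpolyXU -tnth_nth tnth_mktuple big_split_ord /=.
congr (_ + _); rewrite (bigD1 i) //= big1 ?addr0 => [|j ji].
- by rewrite block_mxEdl mxE eqxx mulr1n.
- by rewrite block_mxEdl mxE eq_sym (negPf ji) mulr0n scale0r.
- by rewrite block_mxEdr mxE eqxx mulr1n.
- by rewrite block_mxEdr mxE eq_sym (negPf ji) mulr0n scale0r.
Qed.

Lemma sigma_xvar m (i : 'I_m) : poly_act (mV m) sigma (xvar i) = yvar i.
Proof. by rewrite poly_act_xvar sigmaV !mxE /= scale0r add0r scale1r. Qed.

Lemma sigma_yvar m (i : 'I_m) : poly_act (mV m) sigma (yvar i) = xvar i.
Proof. by rewrite poly_act_yvar sigmaV !mxE /= scale0r addr0 scale1r. Qed.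

Lemma tau_xvar m (a : {unit F}) (i : 'I_m) :
  poly_act (mV m) (tau a) (xvar i) = (val a)^-1 *: xvar i.
Proof. by rewrite poly_act_xvar tauV !mxE /= mulr1n mulr0n scale0r addr0. Qed.

Lemma tau_yvar m (a : {unit F}) (i : 'I_m) :
  poly_act (mV m) (tau a) (yvar i) = val a *: yvar i.
Proof.
by rewrite poly_act_yvar tauV !mxE /= mulr1n mulr0n scale0r add0r invrK.
Qed.

End O2plus.

(* Main.v *)
From mathcomp Require Import all_boot all_order all_algebra all_fingroup.
From mathcomp Require Import mxrepresentation mpoly.
From mathcomp Require Import cyclic finfield zify.
Require Import Defs.

Set Implicit Arguments.
Unset Strict Implicit.
Unset Printing Implicit Defensive.

Import Order.TTheory GRing.Theory.
Local Open Scope ring_scope.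

(** Write N = q - 1, which is odd because q is a power of 2. The torus acts on
    a monomial M by the character (y-degree) - (x-degree), and sigma exchanges
    each x_i with y_i. So M is fixed by the torus exactly when its x-degree and
    its y-degree are congruent modulo N ([balanced]), and the invariants are
    spanned by the orbit sums O(M) = M + sigma M of balanced M and by the
    monomials fixed by sigma, which are products of the norms x_i y_i
    ([swap_invariant_ind]).

    Upper bound. By induction on the degree, O(M) is generated in degrees at
    most max(N, m). If a norm divides M it factors out of O(M). Otherwise, if
    deg M > max(N, m), some variable v divides M twice, since at most one
    variable of each of the m pairs occurs in M; and then M = M1 M2 with M1 and
    M2 both balanced and both divisible by v ([balanced_split]). Now
       O(M) = O(M1) O(M2) - O(M1 (sigma M2)),
    and the last monomial is divisible by the norm of v ([gen_orbit_sum]).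

    Lower bound. A linear form that kills 1 and all homogeneous polynomials
    outside degree d, and whose kernel on the invariants is closed under
    products, vanishes on everything that invariants of degree below d generate
    ([derivation_lower_bound]). Two such forms are used. For d = N it is the
    coefficient of x_1^N: a proper nontrivial divisor of x_1^N is not balanced,
    so it occurs in no invariant, while x_1^N + y_1^N is invariant. For
    d = m > N it is the coefficient of t_1 ... t_m after the substitution
    x_i, y_i |-> t_i, except y_1 |-> 0. In characteristic 2 the substitution
    turns an invariant into a polynomial in which no nontrivial squarefree
    monomial prime to t_1 occurs, because M and sigma M have the same image
    there ([collapse_eq0]); and of two complementary factors of t_1 ... t_m one
    is prime to t_1. The form takes the value 1 on O(M) for
    M = x_1 ... x_p y_(p+1) ... y_m, and p > 0 can be chosen with M balanced
    because N is odd and N < m. *)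

(** * Monomials in two sets of variables *)

Section Monomials.

Variable m : nat.
Implicit Types (v w : 'I_(m + m)) (M : 'X_{1..m + m}).

Definition swap v : 'I_(m + m) :=
  match split v with inl i => rshift m i | inr i => lshift m i end.

Definition is_x v : bool := (v < m)%N.

Lemma swapl i : swap (lshift m i) = rshift m i.
Proof. by rewrite /swap -[lshift m i]/(unsplit (inl i)) unsplitK. Qed.

Lemma swapr i : swap (rshift m i) = lshift m i.
Proof. by rewrite /swap -[rshift m i]/(unsplit (inr i)) unsplitK. Qed.

Lemma is_xl i : is_x (lshift m i).
Proof. by rewrite /is_x /=. Qed.

Lemma is_xr i : is_x (rshift m i) = false.
Proof. by rewrite /is_x /= ltnNge leq_addr. Qed.

Lemma swapK : involutive swap.
Proof.
by move=> v; case: (split_ordP v) => i ->; rewrite ?swapl swapr ?swapl.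
Qed.

Lemma is_x_swap v : is_x (swap v) = ~~ is_x v.
Proof.
by case: (split_ordP v) => i ->; rewrite ?swapl ?swapr is_xl is_xr.
Qed.

Lemma swap_neq v : swap v != v.
Proof. by apply/eqP=> e; have := is_x_swap v; rewrite e; case: is_x. Qed.

Definition swapm M : 'X_{1..m + m} := [multinom M (swap v) | v < m + m].

Lemma swapmE M v : swapm M v = M (swap v).
Proof. exact: mnmE. Qed.

Lemma swapmK : involutive swapm.
Proof. by move=> M; apply/mnmP=> v; rewrite !swapmE swapK. Qed.

Lemma swapmD M1 M2 : swapm (M1 + M2) = (swapm M1 + swapm M2)%MM.
Proof. by apply/mnmP=> v; rewrite !(swapmE, mnmDE). Qed.

Definition side_deg (b : bool) M : nat := (\sum_(v | is_x v == b) M v)%N.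

Lemma side_degD b M1 M2 :
  side_deg b (M1 + M2) = (side_deg b M1 + side_deg b M2)%N.
Proof. by rewrite -big_split; apply: eq_bigr => v _; rewrite mnmDE. Qed.

Lemma side_degU b v : side_deg b U_(v)%MM = (is_x v == b).
Proof.
rewrite /side_deg; case: (boolP (is_x v == b)) => [vb|vb].
  rewrite (bigD1 v) //= mnm1E eqxx big1 // => w /andP[_ wv].
  by rewrite mnm1E eq_sym (negPf wv).
rewrite big1 // => w wb; rewrite mnm1E; case: eqP => // e.
by rewrite e wb in vb.
Qed.

Lemma side_degMn b M k : side_deg b (M *+ k) = (side_deg b M * k)%N.
Proof. by rewrite big_distrl; apply: eq_bigr => v _; rewrite mulmnE. Qed.

Lemma side_deg_swapm b M : side_deg b (swapm M) = side_deg (~~ b) M.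
Proof.
rewrite /side_deg (reindex_inj (inv_inj swapK)); apply: eq_big => v.
  by rewrite is_x_swap; case: b (is_x v) => [] [].
by rewrite swapmE swapK.
Qed.

Lemma side_deg_trueE M : side_deg true M = (\sum_(i < m) M (lshift m i))%N.
Proof.
rewrite /side_deg big_mkcond big_split_ord /= [X in (_ + X)%N]big1 ?addn0.
  by apply: eq_bigr => i _; rewrite is_xl.
by move=> i _; rewrite is_xr.
Qed.

Lemma mdeg_side b M : mdeg M = (side_deg b M + side_deg (~~ b) M)%N.
Proof.
rewrite mdegE (bigID (fun v => is_x v == b)); congr (_ + _)%N.
by apply: eq_bigl => v; case: b (is_x v) => [] [].
Qed.

Lemma mdeg_swapm M : mdeg (swapm M) = mdeg M.
Proof. by rewrite !(mdeg_side true) !side_deg_swapm addnC. Qed.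

Definition balanced N M : bool :=
  (side_deg true M == side_deg false M %[mod N])%N.

Lemma balanced_side N b M :
  balanced N M = (side_deg b M == side_deg (~~ b) M %[mod N])%N.
Proof. by case: b; rewrite // eq_sym. Qed.

Lemma balanced_swapm N M : balanced N (swapm M) = balanced N M.
Proof. by rewrite /balanced !side_deg_swapm eq_sym. Qed.

Lemma balancedD N M1 M2 :
  balanced N M1 -> balanced N (M1 + M2) = balanced N M2.
Proof.
move=> /eqP b1; rewrite /balanced !side_degD -(modnDml (side_deg true M1)) b1.
by rewrite modnDml eqn_modDl.
Qed.

(** The exponent of the norm x_i y_i of a variable under sigma. *)
Definition norm_mnm v : 'X_{1..m + m} := (U_(v) + U_(swap v))%MM.

Lemma swapm_norm v : swapm (norm_mnm v) = norm_mnm v.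
Proof.
apply/mnmP=> w; rewrite swapmE !mnmDE !mnm1E.
by rewrite -{1}[v]swapK !(inj_eq (inv_inj swapK)) addnC.
Qed.

Lemma balanced_norm N v : balanced N (norm_mnm v).
Proof.
by rewrite /balanced !side_degD !side_degU is_x_swap; case: is_x.
Qed.

Lemma mdeg_norm v : mdeg (norm_mnm v) = 2.
Proof. by rewrite mdegD !mdeg1. Qed.

Lemma norm_factor M v :
  (0 < M v)%N -> (0 < M (swap v))%N -> {M' | M = (norm_mnm v + M')%MM}.
Proof.
move=> Mv Ms; exists (M - norm_mnm v)%MM; rewrite addmC submK //.
apply/mnm_lepP=> w; rewrite mnmDE !mnm1E.
have [<-|_] := eqVneq v w; first by rewrite (negPf (swap_neq v)).
by case: eqP => // <-.
Qed.

End Monomials.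

(** * Splitting balanced monomials *)

Lemma sub_mnm_exists n (M : 'X_{1..n}) k :
  (k <= mdeg M)%N -> exists2 M' : 'X_{1..n}, (M' <= M)%MM & mdeg M' = k.
Proof.
elim: k => [|k IH] kM.
  by exists 0%MM; [apply/mnm_lepP=> i; rewrite mnm0E | rewrite mdeg0].
have [M' M'M M'k] := IH (ltnW kM).
have : [exists i, M' i < M i]%N.
  apply: contraTT kM => /existsPn h; rewrite -leqNgt -M'k !mdegE.
  by apply: leq_sum => i _; rewrite leqNgt h.
case/existsP=> i Mi; exists (M' + U_(i))%MM.
  apply/mnm_lepP=> j; rewrite mnmDE mnm1E.
  case: eqP => [<-|_]; rewrite ?addn1 ?addn0 //.
  exact: (mnm_lepP M'M).
by rewrite mdegD mdeg1 M'k addn1.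
Qed.

Section Split.
Variables (m N : nat).
Hypothesis N3 : (2 < N)%N.
Implicit Types (M : 'X_{1..m + m}).

(** This is a statement on zero-sum sequences over Z/N with terms 1 and -1.
    A repeated variable v exists since M has at most m distinct variables. If
    a variable w of the other side occurs, M1 = v w is balanced and v divides
    the rest. Otherwise M lives on one side, its degree is a multiple of N
    above N, and M1 can be any divisor of degree N which contains v but not
    all the factors v of M. *)
Lemma balanced_split M :
    balanced N M -> (maxn N m < mdeg M)%N ->
    (forall v, (M v == 0) || (M (swap v) == 0))%N ->
  exists v M1 M2, [/\ M = (M1 + M2)%MM, balanced N M1, balanced N M2,
     (0 < M1 v)%N & (0 < M2 v)%N].
Proof.
move=> bM; rewrite gtn_max => /andP[NM mM] disj.
have /existsP[v v2] : [exists v, 1 < M v]%N.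
  apply: contraTT mM => /existsPn h; rewrite -leqNgt mdegE big_split_ord /=.
  rewrite -big_split /= -[leqRHS]card_ord -sum1_card; apply: leq_sum => i _.
  have := disj (lshift m i); rewrite swapl.
  by have := h (lshift m i); have := h (rshift m i); lia.
pose b := is_x v; exists v.
have [/existsP[w /andP[wb w0]]|none] :=
  boolP [exists w, (is_x w != b) && (0 < M w)]%N.
  have vw : v != w by apply: contraNneq wb => <-.
  have b1 : balanced N (U_(v) + U_(w)).
    rewrite (balanced_side _ b) !side_degD !side_degU eqxx (negPf wb).
    by rewrite -[is_x v]/b; case: b (is_x w) wb => [] [].
  have EM : M = (U_(v) + U_(w) + (M - (U_(v) + U_(w))))%MM.
    rewrite addmC submK //; apply/mnm_lepP=> j; rewrite mnmDE !mnm1E.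
    have [<-|_] := eqVneq v j; first by rewrite eq_sym (negPf vw) addn0 ltnW.
    by case: eqP => // <-.
  exists (U_(v) + U_(w))%MM, (M - (U_(v) + U_(w)))%MM; split=> //.
  - by rewrite -(balancedD _ b1) -EM.
  - by rewrite mnmDE mnm1E eqxx.
  by rewrite mnmBE mnmDE !mnm1E eqxx eq_sym (negPf vw); lia.
have Mb0 : side_deg (~~ b) M = 0%N.
  rewrite /side_deg big1 // => w /eqP wb; move/existsPn/(_ w): none.
  by rewrite wb; case: (b) => /=; rewrite -leqNgt leqn0 => /eqP.
have Mb : mdeg M = side_deg b M by rewrite (mdeg_side b) Mb0 addn0.
have NdM : (N %| mdeg M)%N.
  by move: bM; rewrite (balanced_side _ b) Mb0 -Mb mod0n.
have vM : (U_(v) + U_(v) <= M)%MM.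
  by apply/mnm_lepP=> j; rewrite mnmDE !mnm1E; case: eqP => // <-.
have dM : mdeg M = (mdeg (M - (U_(v) + U_(v))) + 2)%N.
  by rewrite -[in LHS](submK vM) !mdegD !mdeg1.
(* the two factors v are set aside, one for each part *)
have [|M' M'M dM'] := @sub_mnm_exists _ (M - (U_(v) + U_(v)))%MM (N - 1).
  lia.
have EM : M = (M' + U_(v) + (M - (U_(v) + U_(v)) - M' + U_(v)))%MM.
  rewrite -[LHS](submK vM) -[X in (X + (_ + _))%MM](submK M'M).
  by apply/mnmP=> j; rewrite !mnmDE; lia.
set M1 := (M' + U_(v))%MM in EM *; set M2 := (M - _ - M' + U_(v))%MM in EM *.
have d1 : mdeg M1 = N by rewrite mdegD mdeg1 dM'; lia.
have b1 : balanced N M1.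
  have z : side_deg (~~ b) M1 = 0%N by move: Mb0; rewrite EM side_degD; lia.
  rewrite (balanced_side _ b) z mod0n.
  have <- : N = side_deg b M1 by rewrite -d1 (mdeg_side b) z addn0.
  by rewrite modnn.
exists M1, M2; split=> //; first by rewrite -(balancedD _ b1) -EM.
all: by rewrite mnmDE mnm1E eqxx addn1.
Qed.

End Split.

(** * The action on monomials and the span of the invariants *)

Section Action.
Variables (F : finFieldType) (m : nat).
Implicit Types (f : {mpoly F[m + m]}) (M : 'X_{1..m + m}).

Lemma poly_actM g h f : g \in O2plus F -> h \in O2plus F ->
  poly_act (mV F m) (g * h)%g f = poly_act (mV F m) g (poly_act (mV F m) h f).
Proof.
move=> gG hG; rewrite /poly_act.
have E i k : mV_mx m (g * h)^-1%g i k =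
    \sum_j mV_mx m h^-1%g i j * mV_mx m g^-1%g j k.
  by rewrite invMg -[mV_mx m]/(repr_mx (mV F m)) repr_mxM ?groupV // mxE.
rewrite [in RHS](comp_mpolyEX f) raddf_sum (comp_mpolyEX f).
apply: eq_bigr => M _ /=.
rewrite comp_mpolyZ; congr (_ *: _); rewrite !comp_mpolyX rmorph_prod /=.
apply: eq_bigr => i _; rewrite rmorphXn !tnth_mktuple; congr (_ ^+ _).
rewrite raddf_sum /=.
under [RHS]eq_bigr => j _ do
  rewrite comp_mpolyZ comp_mpolyXU -tnth_nth tnth_mktuple scaler_sumr.
rewrite exchange_big /=; apply: eq_bigr => k _; rewrite E scaler_suml.
by apply: eq_bigr => j _; rewrite scalerA.
Qed.

Lemma poly_act1 f : poly_act (mV F m) 1%g f = f.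
Proof.
rewrite /poly_act -[RHS]comp_mpoly_id; congr (comp_mpoly _ _).
apply: eq_from_tnth => i; rewrite !tnth_mktuple invg1 repr_mx1.
rewrite (bigD1 i) //= mxE eqxx scale1r big1 ?addr0 // => j ji.
by rewrite mxE eq_sym (negPf ji) scale0r.
Qed.

Lemma invariant_generators f :
  poly_act (mV F m) (sigma F) f = f ->
  (forall a, poly_act (mV F m) (tau a) f = f) -> invariant (mV F m) f.
Proof.
move=> fs ft g /gen_prodgP[k [c cG ->]]; elim: k c cG => [|k IH] c cG.
  by rewrite big_ord0 poly_act1.
have cO i : c i \in O2plus F by apply: mem_gen.
rewrite big_ord_recr /= poly_actM ?group_prod //.
have -> : poly_act (mV F m) (c ord_max) f = f.
  by case/setU1P: (cG ord_max) => [->|/imsetP[a _ ->]].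
by apply: (IH (fun i => c (widen_ord (leqnSn k) i))) => i.
Qed.

Lemma poly_act_mpolyX g M :
  poly_act (mV F m) g 'X_[M] = \prod_v poly_act (mV F m) g 'X_v ^+ M v.
Proof.
rewrite {1}/poly_act comp_mpolyX; apply: eq_bigr => v _.
by rewrite /poly_act comp_mpolyXU -tnth_nth.
Qed.

Lemma sigma_mpolyX M : poly_act (mV F m) (sigma F) 'X_[M] = 'X_[swapm M].
Proof.
rewrite poly_act_mpolyX mpolyXE_id (reindex_inj (inv_inj (@swapK m))).
apply: eq_bigr => v _; rewrite swapmE; congr (_ ^+ _).
case: (split_ordP v) => i ->; rewrite ?swapl ?swapr.
  exact: sigma_yvar.
exact: sigma_xvar.
Qed.

Lemma tau_mpolyX (a : {unit F}) M :
  poly_act (mV F m) (tau a) 'X_[M] =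
  ((val a)^-1 ^+ side_deg true M * (val a) ^+ side_deg false M) *: 'X_[M].
Proof.
rewrite poly_act_mpolyX mpolyXE_id /side_deg -!prodrXr.
rewrite !(big_mkcond (fun v => _ == _)) -big_split /= -scaler_prod.
apply: eq_bigr => v _; rewrite -[X in _ = X *: _]/(_ * _).
case: (split_ordP v) => i ->; rewrite ?is_xl ?is_xr /= ?mul1r ?mulr1.
  by rewrite [poly_act _ _ _]tau_xvar exprZn.
by rewrite [poly_act _ _ _]tau_yvar exprZn.
Qed.

Lemma poly_actE g f :
  poly_act (mV F m) g f =
  \sum_(M <- msupp f) f@_M *: poly_act (mV F m) g 'X_[M].
Proof. exact: comp_mpolyEX. Qed.

Lemma invariant_swap f M : invariant (mV F m) f -> f@_(swapm M) = f@_M.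
Proof.
move=> fG; have sG : sigma F \in O2plus F by rewrite mem_gen ?setU11.
rewrite -{2}(fG _ sG) poly_actE {1}[f]mpolyE !raddf_sum; apply: eq_bigr => K _.
rewrite sigma_mpolyX /= !mcoeffZ !mcoeffX; congr (_ * _%:R).
by rewrite -{1}[K]swapmK (inj_eq (inv_inj (@swapmK m))).
Qed.

(** Comparing coefficients in f and tau_a f for a generator a of the unit group
    gives a^(x-degree) = a^(y-degree), and a has order #|F| - 1. *)
Lemma invariant_balanced f M :
  invariant (mV F m) f -> f@_M != 0 -> balanced (#|F| - 1) M.
Proof.
move=> fG fM; have /cyclicP[a Ea] := field_unit_group_cyclic [set: {unit F}]%G.
have ordA : #[a]%g = (#|F| - 1)%N.
  by rewrite orderE -Ea card_finField_unit subn1.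
have tG : tau a \in O2plus F by rewrite mem_gen // setU1r // imset_f.
have a0 : val a != 0 by rewrite -unitfE; exact: valP.
set c := (val a)^-1 ^+ side_deg true M * (val a) ^+ side_deg false M.
have : f@_M = f@_M * c.
  rewrite -{1}(fG _ tG) poly_actE [in RHS](mpolyE f) !raddf_sum mulr_suml.
  apply: eq_bigr => K _; rewrite tau_mpolyX /= !mcoeffZ !mcoeffX.
  by case: eqP => [->|]; rewrite ?mulr1 ?mulr0 ?mul0r.
rewrite -{1}[f@_M]mulr1 => /(mulfI fM) c1.
have : (val a) ^+ side_deg true M = (val a) ^+ side_deg false M.
  by rewrite -[LHS]mulr1 c1 mulrA exprVn divff ?expf_neq0 // mul1r.
rewrite -!FinRing.val_unitX => /val_inj /eqP.
by rewrite eq_expg_mod_order ordA.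
Qed.

Lemma tau_fixes_balanced (a : {unit F}) M :
  balanced (#|F| - 1) M -> poly_act (mV F m) (tau a) 'X_[M] = 'X_[M].
Proof.
move=> bM; rewrite tau_mpolyX.
have a0 : val a != 0 by rewrite -unitfE; exact: valP.
have aN : (a ^+ (#|F| - 1) = 1)%g.
  by rewrite subn1 -card_finField_unit expg_cardG ?inE.
have e : val a ^+ side_deg true M = val a ^+ side_deg false M.
  rewrite -!FinRing.val_unitX; congr (val _).
  by rewrite -(expg_mod _ aN) (eqP bM) expg_mod.
rewrite exprVn (_ : _ * _ = 1) ?scale1r //.
by apply: (canLR (mulKf (expf_neq0 _ a0))); rewrite mulr1; exact/esym.
Qed.

Definition orbit_sum M : {mpoly F[m + m]} := 'X_[M] + 'X_[swapm M].

Lemma invariant_orbit_sum M :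
  balanced (#|F| - 1) M -> invariant (mV F m) (orbit_sum M).
Proof.
move=> bM; apply: invariant_generators => [|a];
  rewrite /orbit_sum /poly_act raddfD /=.
  by rewrite [X in X + _]sigma_mpolyX [X in _ + X]sigma_mpolyX swapmK addrC.
by congr (_ + _); apply: tau_fixes_balanced; rewrite ?balanced_swapm.
Qed.

Lemma invariant_fixed M : swapm M = M -> invariant (mV F m) 'X_[M].
Proof.
move=> sM; apply: invariant_generators => [|a].
  by rewrite sigma_mpolyX sM.
apply: tau_fixes_balanced.
by rewrite /balanced -[in side_deg true _]sM side_deg_swapm.
Qed.

(** The support of f is a disjoint union of fixed monomials and of pairs
    {M, sigma M} on which the coefficients agree, so f is a combination of
    fixed monomials and orbit sums; an order on the monomials serves to choose
    one member of each pair. *)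
Lemma swap_invariant_ind (P : {mpoly F[m + m]} -> Prop) f :
    P 0 -> (forall g h, P g -> P h -> P (g + h)) ->
    (forall c g, P g -> P (c *: g)) ->
    (forall M, M \in msupp f -> swapm M = M -> P 'X_[M]) ->
    (forall M, M \in msupp f -> P (orbit_sum M)) ->
  (forall M, f@_(swapm M) = f@_M) -> P f.
Proof.
move=> P0 PD PZ PX Po fs.
have sP : perm_eq (msupp f) (map (@swapm m) (msupp f)).
  apply: uniq_perm;
    rewrite ?(map_inj_uniq (inv_inj (@swapmK m))) ?msupp_uniq // => M.
  by rewrite -[M in RHS]swapmK (mem_map (inv_inj (@swapmK m))) !mcoeff_msupp fs.
rewrite [f]mpolyE (bigID (fun M => swapm M == M)) /=; apply: (PD).
  rewrite big_seq_cond; elim/big_rec: _ => // M g /andP[Mf /eqP sM] Pg.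
  by apply: (PD) => //; apply: (PZ); apply: (PX).
rewrite (bigID (fun M => M < swapm M)%O) /=.
rewrite [X in _ + X](perm_big _ sP) /= big_map.
rewrite [X in _ + X](eq_bigl
  (fun M => (swapm M != M) && (M < swapm M)%O)); last first.
  by move=> M; rewrite swapmK eq_sym; case: ltgtP.
rewrite -big_split /= big_seq_cond; elim/big_rec: _ => // M g /andP[Mf _] Pg.
by apply: (PD) => //; rewrite fs -scalerDr; apply: (PZ); apply: (Po).
Qed.

End Action.

(** * Generation in degrees at most max(q - 1, m) *)

Section UpperBound.

Variables (F : finFieldType) (m : nat).
Hypothesis F_gt3 : (3 < #|F|)%N.
Implicit Types (M : 'X_{1..m + m}).

Let N := (#|F| - 1)%N.
Let D : {mpoly F[m + m]} -> Prop :=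
  gen_subalg (fun h => invariant (mV F m) h /\
                       exists d : nat, (d <= maxn N m)%N /\ h \is d.-homog).

Lemma orbit_sumM M1 M2 :
  orbit_sum F M1 * orbit_sum F M2 =
  orbit_sum F (M1 + M2) + orbit_sum F (M1 + swapm M2).
Proof.
rewrite /orbit_sum !swapmD swapmK !mpolyXD mulrDl !mulrDr.
by rewrite [X in _ + X = _]addrC addrACA.
Qed.

Lemma orbit_sum_norm v M :
  orbit_sum F (norm_mnm v + M) = 'X_[norm_mnm v] * orbit_sum F M.
Proof. by rewrite /orbit_sum swapmD swapm_norm !mpolyXD mulrDr. Qed.

Lemma homog_orbit_sum M : orbit_sum F M \is (mdeg M).-homog.
Proof. by rewrite rpredD ?dhomogX //= mdeg_swapm. Qed.

Lemma gen_norm v : D 'X_[norm_mnm v].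
Proof.
apply: gen_subalg_gen; split; first exact/invariant_fixed/swapm_norm.
exists 2; rewrite dhomogX /= mdeg_norm eqxx leq_max.
by split=> //; rewrite /N; lia.
Qed.

(** Both factors in the splitting M = M1 M2 of [balanced_split] contain v, so
    M1 (sigma M2) contains v and sigma v, and its orbit sum is the norm of v
    times an orbit sum of smaller degree. *)
Lemma gen_orbit_sum M : balanced N M -> D (orbit_sum F M).
Proof.
have [k] := ubnP (mdeg M); elim: k M => // k IH M /ltnSE dM bM.
(* if a norm divides the monomial, the other factor has smaller degree *)
have norm_step (K : 'X_{1..m + m}) v : (mdeg K <= k)%N -> balanced N K ->
    (0 < K v)%N -> (0 < K (swap v))%N -> D (orbit_sum F K).
  move=> dK bK Kv Ks; have [K' EK] := norm_factor Kv Ks.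
  rewrite EK orbit_sum_norm; apply: gen_subalg_mul; first exact: gen_norm.
  apply: IH; first by move: dK; rewrite EK mdegD mdeg_norm; lia.
  by rewrite -(balancedD _ (balanced_norm N v)) -EK.
have [small|big] := leqP (mdeg M) (maxn N m).
  apply: gen_subalg_gen; split; first exact: invariant_orbit_sum.
  by exists (mdeg M); split=> //; apply: homog_orbit_sum.
have [/existsP[v /andP[]]|/existsPn disj] :=
  boolP [exists v, (0 < M v) && (0 < M (swap v))]%N; first exact: norm_step.
have [||//||v [M1 [M2 [EM b1 b2 v1 v2]]]] := @balanced_split m N _ M.
- by rewrite /N; lia.
- exact: bM.
- by move=> v; have := disj v; lia.
have pos (K : 'X_{1..m + m}) : (0 < K v)%N -> (0 < mdeg K)%N.
  by rewrite !lt0n mdeg_eq0; apply: contraNneq => ->; rewrite mnm0E.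
have dE : mdeg M = (mdeg M1 + mdeg M2)%N by rewrite EM mdegD.
have -> : orbit_sum F M =
    orbit_sum F M1 * orbit_sum F M2 + (-1)%:A * orbit_sum F (M1 + swapm M2).
  by rewrite orbit_sumM -EM scaleN1r mulN1r addrK.
apply: gen_subalg_add; apply: gen_subalg_mul.
- by apply: IH => //; have := pos _ v2; lia.
- by apply: IH => //; have := pos _ v1; lia.
- exact: gen_subalg_scalar.
apply: (norm_step _ v).
- by rewrite mdegD mdeg_swapm -dE.
- by rewrite balancedD // balanced_swapm.
- by rewrite mnmDE addn_gt0 v1.
by rewrite mnmDE swapmE swapK addn_gt0 v2 orbT.
Qed.

Lemma gen_fixed M : swapm M = M -> D 'X_[M].
Proof.
have [k] := ubnP (mdeg M); elim: k M => // k IH M /ltnSE dM sM.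
have [->|M0] := eqVneq M 0%MM.
  by rewrite mpolyX0 -[1]scale1r; apply: gen_subalg_scalar.
have /existsP[v v0] : [exists v, 0 < M v]%N.
  apply: contraNT M0 => /existsPn h; apply/eqP/mnmP=> v; rewrite mnm0E.
  by apply/eqP; rewrite -leqn0 leqNgt h.
have [|M' EM] := norm_factor v0; first by rewrite -swapmE sM.
rewrite EM mpolyXD; apply: gen_subalg_mul; first exact: gen_norm.
apply: IH; first by move: dM; rewrite EM mdegD mdeg_norm; lia.
by apply: (@addmI _ (norm_mnm v)); rewrite -{1}(swapm_norm v) -swapmD -EM.
Qed.

Lemma generated_in_degree_max : generated_in_degree_le (mV F m) (maxn N m).
Proof.
move=> f fG; apply: (swap_invariant_ind (f := f)) =>
  [|g h Dg Dh|c g Dg|M _ sM|M Mf|M].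
- by rewrite -(scale0r 1); apply: gen_subalg_scalar.
- exact: gen_subalg_add.
- by rewrite -mulr_algl; apply: gen_subalg_mul => //; exact: gen_subalg_scalar.
- exact: gen_fixed.
- apply: gen_orbit_sum; apply: invariant_balanced fG _.
  by rewrite -mcoeff_msupp.
- exact: invariant_swap.
Qed.

End UpperBound.

(** * Indecomposable invariants *)

Section LowerBound.

Variables (F : finFieldType) (m : nat).
Implicit Types (f : {mpoly F[m + m]}) (M : 'X_{1..m + m}).

(** The model for L is a derivation at the origin of the ring of invariants:
    L (f h) = L f * h(0) + f(0) * L h vanishes when L f and L h do. Such a form
    kills the decomposable invariants, so L f0 != 0 shows that a generator of
    degree d is needed. *)
Lemma derivation_lower_bound (L : {scalar {mpoly F[m + m]}}) d f0 e :
    L 1 = 0 ->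
    (forall f h, invariant (mV F m) f -> invariant (mV F m) h ->
       L f = 0 -> L h = 0 -> L (f * h) = 0) ->
    (forall d' f, f \is d'.-homog -> d' != d -> L f = 0) ->
    invariant (mV F m) f0 -> L f0 != 0 ->
  generated_in_degree_le (mV F m) e -> (d <= e)%N.
Proof.
move=> L1 LM Ld f0G Lf0 /(_ f0 f0G) gen; rewrite leqNgt.
apply: contraNN Lf0 => ed.
suff : invariant (mV F m) f0 /\ L f0 = 0 by case=> _ ->.
elim: {f0G} gen => [c|f [fG [d' [d'e fd']]]|
  f h _ [fG Lf] _ [hG Lh]|f h _ [fG Lf] _ [hG Lh]].
- split; last by rewrite linearZ /= L1 mulr0.
  by move=> g _; rewrite /poly_act linearZ /= rmorph1.
- split=> //; apply: Ld fd' _; lia.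
- split; last by rewrite linearD /= Lf Lh addr0.
  by move=> g gG; rewrite /poly_act linearD /= [X in X + _]fG // [X in _ + X]hG.
- split; last exact: LM.
  by move=> g gG; rewrite /poly_act rmorphM /= [X in X * _]fG // [X in _ * X]hG.
Qed.

(** Only the factorizations 1 * u and u * 1 of the monomial u are left, and
    their contribution is f(0) * h@_u + f@_u * h(0). *)
Lemma mcoeffM_eq0 n (f h : {mpoly F[n]}) (u : 'X_{1..n}) :
    (forall k1 k2 : 'X_{1..n}, u = (k1 + k2)%MM -> k1 != 0%MM -> k2 != 0%MM ->
       f@_k1 * h@_k2 = 0) ->
  f@_u = 0 -> h@_u = 0 -> (f * h)@_u = 0.
Proof.
move=> split0 fu hu; rewrite mcoeffM big1 // => -[k1 k2] /= /eqP Eu.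
have [k1_0|k1_n0] := eqVneq (k1 : 'X_{1..n}) 0%MM.
  by rewrite Eu k1_0 add0m in hu; rewrite hu mulr0.
have [k2_0|k2_n0] := eqVneq (k2 : 'X_{1..n}) 0%MM.
  by rewrite Eu k2_0 addm0 in fu; rewrite fu mul0r.
exact: split0.
Qed.

(** The witness is x_i^N + y_i^N. *)
Lemma torus_order_bound e (i : 'I_m) : (3 < #|F|)%N ->
  generated_in_degree_le (mV F m) e -> (#|F| - 1 <= e)%N.
Proof.
move=> F_gt3; set N := (#|F| - 1)%N.
pose v := lshift m i; pose u := (U_(v) *+ N)%MM.
have N0 : (0 < N)%N by rewrite /N; lia.
have u0 : (u == 0%MM) = false by rewrite -mdeg_eq0 mdegMn mdeg1; lia.
have ufalse : side_deg false u = 0%N by rewrite side_degMn side_degU is_xl.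
have utrue : side_deg true u = N by rewrite side_degMn side_degU is_xl mul1n.
have bu : balanced N u by rewrite /balanced ufalse utrue modnn mod0n.
apply: (@derivation_lower_bound (mcoeff u) N (orbit_sum F u)) => /=.
- by rewrite mcoeff1 u0.
- move=> f h fG hG; apply: mcoeffM_eq0 => k1 k2 Eu k1_n0 k2_n0.
  have [->|/(invariant_balanced fG) bk1] := eqVneq f@_k1 0.
    by rewrite mul0r.
  move: k1_n0 k2_n0; rewrite -!mdeg_eq0 !(mdeg_side true) /= => k1_n0 k2_n0.
  move: ufalse utrue bk1; rewrite Eu !side_degD /balanced => /eqP.
  rewrite addn_eq0 => /andP[/eqP E1 /eqP E2] ET.
  rewrite E1 mod0n => /dvdn_leq; lia.
- move=> d' f /dhomogP fd'; apply: contraNeq.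
  rewrite -mcoeff_msupp => /fd' /= <-.
  by rewrite mdegMn mdeg1 mul1n.
- exact: invariant_orbit_sum.
rewrite /orbit_sum raddfD /= !mcoeffX eqxx.
rewrite (_ : (swapm u == u) = false) ?addr0 ?oner_neq0 //.
apply/eqP=> /(congr1 (side_deg true)); rewrite side_deg_swapm ufalse utrue; lia.
Qed.

Section Collapse.

Variable i0 : 'I_m.

(** Killing one y breaks the symmetry under sigma; without it the monomials of
    an orbit sum would cancel in characteristic 2. *)
Definition collapse : {mpoly F[m + m]} -> {mpoly F[m]} :=
  comp_mpoly [tuple match split v with
                    | inl i => 'X_i
                    | inr i => if i == i0 then 0 else 'X_i
                    end | v < m + m].

Definition collapse_mnm M : 'X_{1..m} :=
  [multinom M (lshift m i) + M (rshift m i) | i < m].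

Lemma collapse_mnm_swapm M : collapse_mnm (swapm M) = collapse_mnm M.
Proof. by apply/mnmP=> i; rewrite !mnmE swapl swapr addnC. Qed.

Lemma mdeg_collapse M : mdeg (collapse_mnm M) = mdeg M.
Proof.
rewrite !mdegE big_split_ord /= -big_split /=.
by apply: eq_bigr => i _; rewrite mnmE.
Qed.

Lemma collapseX M :
  collapse 'X_[M] = (M (rshift m i0) == 0%N)%:R *: 'X_[collapse_mnm M].
Proof.
rewrite /collapse comp_mpolyX big_split_ord /=.
rewrite (eq_bigr (fun i => 'X_i ^+ M (lshift m i))); last first.
  by move=> i _; rewrite tnth_mktuple -[lshift m i]/(unsplit (inl i)) unsplitK.
rewrite [X in _ * X](eq_bigr
  (fun i => (if i == i0 then 0 else 'X_i) ^+ M (rshift m i))); last first.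
  by move=> i _; rewrite tnth_mktuple -[rshift m i]/(unsplit (inr i)) unsplitK.
case: (eqVneq (M (rshift m i0)) 0%N) => [M0|M0]; last first.
  rewrite [X in _ * X](bigD1 i0) //= eqxx expr0n (negPf M0).
  by rewrite mul0r mulr0 scale0r.
rewrite scale1r mpolyXE_id -big_split; apply: eq_bigr => i _ /=.
rewrite mnmE exprD; case: eqP => // ->.
by rewrite M0 !expr0.
Qed.

Hypothesis F2 : 2 \in [pchar F].

(** A monomial M over u involves neither x_(i0) nor y_(i0), so M and sigma M
    both map to u and cancel in characteristic 2. A monomial fixed by sigma
    maps to a square, which u is not. *)
Lemma collapse_eq0 f (u : 'X_{1..m}) :
    (forall M, f@_(swapm M) = f@_M) ->
    u != 0%MM -> (forall i, (u i <= 1)%N) -> u i0 = 0%N ->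
  (collapse f)@_u = 0.
Proof.
move=> fs u_n0 u1 u_i0.
apply: (swap_invariant_ind (P := fun g => (collapse g)@_u = 0)) fs =>
  [|g h Eg Eh|c g Eg|M _ sM|M _].
- by rewrite /collapse raddf0 mcoeff0.
- by rewrite /collapse raddfD /= mcoeffD [X in X + _]Eg [X in _ + X]Eh addr0.
- by rewrite /collapse linearZ /= mcoeffZ [X in _ * X]Eg mulr0.
- rewrite collapseX mcoeffZ mcoeffX.
  case: (collapse_mnm M =P u) => [Mu|]; last by rewrite mulr0.
  case/negP: u_n0; apply/eqP/mnmP=> i; rewrite mnm0E.
  have := u1 i; rewrite -Mu mnmE -{1 3}sM swapmE swapl; lia.
rewrite /orbit_sum /collapse raddfD /= mcoeffD.
rewrite -![comp_mpoly _ _]/(collapse _) !collapseX collapse_mnm_swapm.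
rewrite !mcoeffZ mcoeffX.
case: (collapse_mnm M =P u) => [Mu|]; last by rewrite !mulr0 addr0.
move: u_i0; rewrite -Mu mnmE swapmE swapr => /eqP.
by rewrite addn_eq0 => /andP[-> ->]; rewrite !mulr1 -mulr2n (pcharf0 F2).
Qed.

End Collapse.

(** The witness is x_1 ... x_p y_(p+1) ... y_m plus its image under sigma. *)
Lemma copies_bound e : 2 \in [pchar F] -> (0 < m)%N ->
  (#|F| - 1 < m)%N -> odd (#|F| - 1) ->
  generated_in_degree_le (mV F m) e -> (m <= e)%N.
Proof.
move=> F2 m0; set N := (#|F| - 1)%N => Nm oddN.
pose i0 := Ordinal m0; pose u : 'X_{1..m} := [multinom 1 | _ < m].
(* p is m / 2 or (m + N) / 2, whichever is an integer *)
have [p [p0 pm bp]] : exists p, [/\ 0 < p, p <= m & p == m - p %[mod N]]%N.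
  case om : (odd m).
    have := odd_double_half (m + N); rewrite oddD om oddN /= => Ep.
    exists (m + N)./2; split; [lia | lia |].
    have {1}-> : (m + N)./2 = (m - (m + N)./2 + N)%N by lia.
    by rewrite modnDr.
  have := odd_double_half m; rewrite om /= => Ep.
  by exists m./2; split; [lia | lia | rewrite (_ : m - m./2 = m./2)%N //; lia].
pose M : 'X_{1..m + m} :=
  [multinom match split v with
            | inl i => (i < p)%N
            | inr i => (p <= i)%N
            end | v < m + m].
have Ml i : M (lshift m i) = (i < p)%N.
  by rewrite mnmE -[lshift m i]/(unsplit (inl i)) unsplitK.
have Mr i : M (rshift m i) = (p <= i)%N.
  by rewrite mnmE -[rshift m i]/(unsplit (inr i)) unsplitK.
have cM : collapse_mnm M = u.
  by apply/mnmP=> i; rewrite [LHS]mnmE Ml Mr [RHS]mnmE; case: leqP.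
have Mtrue : side_deg true M = p.
  rewrite side_deg_trueE -[RHS]card_ord -sum1_card.
  rewrite (big_ord_widen m (fun _ => 1)%N pm).
  rewrite [RHS]big_mkcond; apply: eq_bigr => i _.
  by rewrite Ml; case: (i < p)%N.
have uE : mdeg u = m.
  rewrite mdegE -[RHS]card_ord -sum1_card.
  by apply: eq_bigr => i _; rewrite mnmE.
have bM : balanced N M.
  have := mdeg_side true M; rewrite -mdeg_collapse cM uE Mtrue => /= Em.
  by rewrite /balanced Mtrue (_ : side_deg false M = m - p)%N //; lia.
pose L : {scalar {mpoly F[m + m]}} := mcoeff u \o collapse i0.
apply: (@derivation_lower_bound L m (orbit_sum F M)) => /=.
- rewrite /collapse rmorph1 mcoeff1; case: eqP => // u0.
  by have := uE; rewrite u0 mdeg0; lia.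
- move=> f h fG hG; rewrite /collapse rmorphM.
  apply: mcoeffM_eq0 => k1 k2 Eu k1_n0 k2_n0.
  have Ei i : (k1 i + k2 i)%N = 1%N by rewrite -mnmDE -Eu mnmE.
  (* u = k1 + k2 has exponent 1 at i0, so k1 or k2 has exponent 0 there *)
  have [k1_i0|k1_i0] := eqVneq (k1 i0) 0%N.
    rewrite [X in X * _](collapse_eq0 F2) ?mul0r // => [M'|i].
      exact: invariant_swap.
    by have := Ei i; lia.
  rewrite [X in _ * X](collapse_eq0 F2) ?mulr0 // => [M'|i|].
  - exact: invariant_swap.
  - by have := Ei i; lia.
  by have := Ei i0; lia.
- move=> d f /dhomogP fd dm.
  rewrite /collapse comp_mpolyEX raddf_sum big_seq big1 //= => K Kf.
  rewrite -[comp_mpoly _ _]/(collapse _ _) collapseX !mcoeffZ mcoeffX.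
  case: (collapse_mnm K =P u) => [Ku|_]; last by rewrite !mulr0.
  by case/eqP: dm; rewrite -uE -Ku mdeg_collapse (fd _ Kf).
- exact: invariant_orbit_sum.
rewrite /orbit_sum /collapse raddfD /= mcoeffD.
rewrite -![comp_mpoly _ _]/(collapse _ _).
rewrite !collapseX collapse_mnm_swapm cM !mcoeffZ mcoeffX eqxx.
by rewrite swapmE swapr Ml Mr p0 leqNgt p0 !mulr1 addr0 oner_neq0.
Qed.

End LowerBound.

Local Close Scope ring_scope.

Theorem corollary1p3 (s : nat) (hs : (2 <= s)%N) (q : nat) (hq : q = (2 ^ s)%N)
    (F : finFieldType) (hF : #|F| = q) (m : nat) (hm : (1 <= m)%N) :
  is_noether_number (mV F m) (maxn (q - 1) m).
Proof.
have q4 : (3 < q)%N by rewrite hq; exact: (@leq_pexp2l 2 2 s isT hs).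
have F2 : 2%N \in [pchar F]%R.
  by apply: (card_finPcharP (n := s)); rewrite // hF.
have odd_q1 : odd (q - 1).
  by rewrite oddB ?(leq_trans _ q4) // hq oddX; case: (s) hs.
rewrite -hF in q4 odd_q1 *; split=> [|e gen].
  exact: generated_in_degree_max.
have N_le := torus_order_bound (Ordinal hm) q4 gen.
rewrite geq_max N_le /=.
have [|N_lt] := leqP m (#|F| - 1); first by move/leq_trans; apply.
exact: copies_bound gen.
Qed.
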